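(* Let $\mathbf{s}_e,\mathbf{s}_e'\in\mathbb{Z}^e[m]$ and $w\in\mathbb{Z}_{\ge0}$. Then $B(\mathbf{s}_e,w)$ and $B(\mathbf{s}_e',w)$ are in the same orbit under the action of the affine symmetric group $\widetilde{\mathfrak{S}}_e$ if and only if the $l$-multicharges associated with $\mathbf{s}_e$ and $\mathbf{s}_e'$ are the same.
   Context: Fix integers $e\ge 2$, $l\ge 1$ and $m\in\mathbb{Z}$. For $r\ge1$, $\Pi^r$ is the set of $r$-partitions ($r$-tuples of partitions), $\boldsymbol{\emptyset}$ is the empty one, and $\mathbb{Z}^r[m]=\{(s_0,\dots,s_{r-1})\in\mathbb{Z}^r:\sum_{i=0}^{r-1}s_i=m\}$. Blocks of Ariki-Koike algebras are labelled $B(\mathbf{s}_e,w)$, where $\mathbf{s}_e\in\mathbb{Z}^e[m]$ is the $e$-core multicharge of the block and $w\in\mathbb{Z}_{\ge0}$ its weight. The affine symmetric group $\widetilde{\mathfrak{S}}_e=\langle\sigma_0,\dots,\sigma_{e-1}\rangle$ acts on $\mathbb{Z}^e[m]$ as follows: for $1\le c\le e-1$, $\sigma_c.\mathbf{s}_e$ is obtained from $\mathbf{s}_e=(s_0,\dots,s_{e-1})$ by exchanging $s_{c-1}$ and $s_c$, and $\sigma_0.\mathbf{s}_e=(s_{e-1}+l,s_1,\dots,s_{e-2},s_0-l)$. It acts on the set of labels $\{B(\mathbf{s}_e,w):\mathbf{s}_e\in\mathbb{Z}^e[m],\ w\in\mathbb{Z}_{\ge0}\}$ by $\sigma.B(\mathbf{s}_e,w)=B(\sigma.\mathbf{s}_e,w)$.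 Symbols. A symbol of charge $m$ is a strictly increasing sequence of integers $(\beta_i)_{i<m}$ with $\beta_j=j$ for all sufficiently negative $j$, identified with the set of its entries. For a partition $\lambda=(\lambda_1\ge\lambda_2\ge\cdots)$ (with $\lambda_k=0$ for large $k$) put $X^m(\lambda)=\{\lambda_j-j+m: j\ge1\}$; this gives a bijection between partitions and symbols of charge $m$. A pair $(\boldsymbol{\lambda},\mathbf{s})\in\Pi^r\times\mathbb{Z}^r$ has $r$-symbol $(X^{s_0}(\lambda^0),\dots,X^{s_{r-1}}(\lambda^{r-1}))$; this is a bijection onto $r$-tuples of symbols. $\tau_e$: for a partition $\lambda$, put $Y^j=\{k\in\mathbb{Z}: j+ke\in X^m(\lambda)\}$ for $0\le j\le e-1$; $\tau_e(\lambda)\in\Pi^e\times\mathbb{Z}^e[m]$ is the pair whose $e$-symbol is $(Y^0,\dots,Y^{e-1})$. $\tau^l$: write each $\beta\in X^m(\lambda)$ uniquely as $\beta=c+ed+elq$ with $0\le c\le e-1$, $0\le d\le l-1$, $q\in\mathbb{Z}$, and let $X_d$ be the set of all $c+eq$ coming from the $\beta$ with this value of $d$; $\tau^l(\lambda)\in\Pi^l\times\mathbb{Z}^l[m]$ is the pair whose $l$-symbol is $(X_{l-1},X_{l-2},\dots,X_0)$. Both maps are bijections from the set of partitions (for fixed $m$). The $e$-core associated with $\mathbf{s}_e\in\mathbb{Z}^e[m]$ is the pair $(\boldsymbol{\lambda}^l,\mathbf{v}^l)=\tau^l\big(\tau_e^{-1}(\boldsymbol{\emptyset},\mathbf{s}_e)\big)\in\Pi^l\times\mathbb{Z}^l[m]$,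 and the $l$-multicharge associated with $\mathbf{s}_e$ is $\mathbf{v}^l$. *)

(* Defs.v *)
From HB Require Import structures.
From mathcomp Require Import all_boot all_order all_algebra.
From mathcomp Require Import perm generic_quotient zify ring boolp classical_sets.

Set Implicit Arguments.
Unset Strict Implicit.
Unset Printing Implicit Defensive.

Import Order.TTheory GRing.Theory Num.Theory.
Local Open Scope ring_scope.
Local Open Scope quotient_scope.

(* [part_fun la k] is the (k+1)-st part of la: parts are indexed from 0. *)
Record partition := Partition {
  part_fun :> nat -> nat;
  part_noninc : forall i j, (i <= j)%N -> (part_fun j <= part_fun i)%N;
  part_fin : exists N, forall k, (N <= k)%N -> part_fun k = 0%N
}.

HB.instance Definition _ := gen_eqMixin partition.
HB.instance Definition _ := gen_choiceMixin partition.

Lemma partition_ext (la mu : partition) : (forall k, la k = mu k) -> la = mu.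
Proof.
case: la mu => [f fn ff] [g gn gf] /= /funext fg; subst g.
by rewrite (Prop_irrelevance fn gn) (Prop_irrelevance ff gf).
Qed.

Definition empty_part : partition.
Proof. by exists (fun _ => 0%N) => //; exists 0%N. Defined.

Definition rpartition (r : nat) := {ffun 'I_r -> partition}.
Definition multicharge (r : nat) := {ffun 'I_r -> int}.

Definition empty_rpart (r : nat) : rpartition r := [ffun=> empty_part].

(* X^m(la), with j running from 1, so that the j-th part is [la j.-1]. *)
Definition symbol (m : int) (la : partition) : set int :=
  [set x | exists2 j : nat, (1 <= j)%N & x = (la j.-1)%:Z - j%:Z + m]%classic.

Lemma symbolE (m : int) (la : partition) (x : int) :
  symbol m la x <-> exists k : nat, x = (la k)%:Z - k%:Z - 1 + m.
Proof.
split=> [[j j1 ->]|[k ->]]; last by exists k.+1 => //=; lia.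
by exists j.-1; lia.
Qed.

Lemma symbol_inj (s t : int) (la mu : partition) :
  symbol s la = symbol t mu -> s = t /\ la = mu.
Proof.
move=> E.
have key (a b : int) (f g : partition) : symbol a f = symbol b g ->
    forall k, (forall i, (i < k)%N ->
       (f i)%:Z - i%:Z - 1 + a = (g i)%:Z - i%:Z - 1 + b) ->
    (g k)%:Z - k%:Z - 1 + b <= (f k)%:Z - k%:Z - 1 + a.
  move=> fg k IH.
  have : symbol a f ((g k)%:Z - k%:Z - 1 + b).
    by rewrite fg; apply/symbolE; exists k.
  move=> /symbolE[i Ei]; case: (ltnP i k) => ik.
    by have := IH i ik; have := part_noninc g (ltnW ik); lia.
  by have := part_noninc f ik; lia.
have EE k : (la k)%:Z - k%:Z - 1 + s = (mu k)%:Z - k%:Z - 1 + t.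
  elim/ltn_ind: k => k IH.
  have h1 := key _ _ _ _ E k IH.
  have h2 := key _ _ _ _ (esym E) k (fun i ik => esym (IH i ik)).
  by lia.
have [N1 h1] := part_fin la; have [N2 h2] := part_fin mu.
have st : s = t.
  have := EE (N1 + N2)%N; rewrite h1 ?leq_addr // h2 ?leq_addl //; lia.
by split=> //; apply: partition_ext => k; have := EE k; lia.
Qed.

Lemma symbol_add (s x : int) (la : partition) :
  (forall y, symbol s la y -> y < x) ->
  exists mu, symbol (s + 1) mu = [set y | y = x \/ symbol s la y]%classic.
Proof.
move=> lax.
have la0 : (la 0%N)%:Z - 1 + s < x.
  by apply: lax; apply/symbolE; exists 0%N; lia.
pose f k := if k is k'.+1 then la k' else `|(x - s)%R|%N.
have fn i j : (i <= j)%N -> (f j <= f i)%N.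
  case: i j => [|i] [|j] //=; last by rewrite ltnS; exact: part_noninc.
  by move=> _; have := part_noninc la (leq0n j); lia.
have ff : exists K, forall k, (K <= k)%N -> f k = 0%N.
  have [K hK] := part_fin la; exists K.+1 => -[|k] //=.
  by move=> Kk; exact: hK.
exists (Partition fn ff); apply/seteqP; split=> y.
  move=> /symbolE[[|k] ->] /=; first by left; lia.
  by right; apply/symbolE; exists k; lia.
move=> [->|/symbolE[k ->]]; apply/symbolE; first by exists 0%N => /=; lia.
by exists k.+1 => /=; lia.
Qed.

Lemma symbol_empty (s x : int) : symbol s empty_part x <-> x < s.
Proof.
split=> [/symbolE[k ->] /=|xs]; first lia.
by apply/symbolE; exists `|(s - x - 1)%R|%N => /=; lia.
Qed.

Lemma symbol_surj (X : set int) (N M : int) :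
  (forall x, x < N -> X x) -> (forall x, X x -> x < M) ->
  exists s la, symbol s la = X.
Proof.
move=> XN XM; have [n Mn] : exists n : nat, M <= N + n%:Z.
  by exists `|(M - N)%R|%N; lia.
have {XM Mn} : forall x, X x -> x < N + n%:Z by move=> x /XM; lia.
elim: n X XN => [|n IH] X XN XM.
  exists N, empty_part; apply/seteqP; split=> x; first by move=> /symbol_empty/XN.
  by move=> /XM xN; apply/symbol_empty; lia.
have [Xn|Xn] := pselect (X (N + n%:Z)); last first.
  apply: IH => // x Xx; have := XM x Xx.
  by case: (x =P N + n%:Z) Xx => [-> //|]; lia.
have [||s [la E]] := IH [set x | X x /\ x <> N + n%:Z]%classic.
- by move=> x xN; split; [exact: XN | lia].
- by move=> x [Xx xn]; have := XM x Xx; lia.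
have [|mu Emu] := @symbol_add s (N + n%:Z) la.
  by move=> y; rewrite E => -[/XM]; lia.
exists (s + 1), mu; rewrite Emu E; apply/seteqP; split=> y /=.
  by move=> [->//|[]].
by move=> Xy; have [->|] := pselect (y = N + n%:Z); [left | right].
Qed.

Definition rsymbol (r : nat) (p : rpartition r * multicharge r) :
  'I_r -> set int := fun i => symbol (p.2 i) (p.1 i).

Lemma rsymbol_inj (r : nat) : injective (@rsymbol r).
Proof.
move=> [la s] [mu t] E.
have {}E i : s i = t i /\ la i = mu i.
  by apply: symbol_inj; exact: (congr1 (fun S => S i) E).
by congr pair; apply/ffunP => i; case: (E i).
Qed.

Definition cofinal_below (X : set int) : Prop :=
  (exists N, forall x, x < N -> X x) /\ (exists M, forall x, X x -> x < M).

Lemma rsymbol_surj (r : nat) (S : 'I_r -> set int) :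
  (forall i, cofinal_below (S i)) -> exists p, rsymbol p = S.
Proof.
move=> hS; have hp i : exists p : partition * int, symbol p.2 p.1 = S i.
  have [[N hN] [M hM]] := hS i.
  by have [s [la E]] := symbol_surj hN hM; exists (la, s).
have [f hf] := choice hp.
exists ([ffun i => (f i).1], [ffun i => (f i).2]).
by apply/funext => i; rewrite /rsymbol /= !ffunE.
Qed.

(* The pair with a given r-symbol: it is unique by [rsymbol_inj], and it exists
   when all the entries are symbols of some charge by [rsymbol_surj]. *)
Definition of_rsymbol (r : nat) (S : 'I_r -> set int) :
  rpartition r * multicharge r :=
  xget (empty_rpart r, [ffun=> 0]) [set p | rsymbol p = S]%classic.

(* [tau_low] is tau with lower index e, [tau_up] is tau with upper index l. *)
Definition tau_low (e : nat) (m : int) (la : partition) :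
  rpartition e * multicharge e :=
  of_rsymbol (fun j : 'I_e =>
    [set k : int | symbol m la ((j : nat)%:Z + k * e%:Z)]%classic).

Definition tau_up_set (e l : nat) (m : int) (la : partition) (d : nat) :
  set int :=
  [set x | exists c q, [/\ 0 <= c < e%:Z,
     symbol m la (c + e%:Z * d%:Z + e%:Z * l%:Z * q) & x = c + e%:Z * q]]%classic.

(* [rev_ord] gives the reversed order X_(l-1), ..., X_0. *)
Definition tau_up (e l : nat) (m : int) (la : partition) :
  rpartition l * multicharge l :=
  of_rsymbol (fun i : 'I_l => tau_up_set e l m la (rev_ord i)).

Lemma symbol_cofinal_below (m : int) (la : partition) :
  cofinal_below (symbol m la).
Proof.
split.
  have [N hN] := part_fin la; exists (m - N%:Z) => x xN.
  apply/symbolE; exists `|(m - 1 - x)%R|%N; rewrite hN; lia.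
exists ((la 0%N)%:Z + m) => x /symbolE[k ->].
by have := part_noninc la (leq0n k); lia.
Qed.

Lemma of_rsymbolK (r : nat) (S : 'I_r -> set int) :
  (forall i, cofinal_below (S i)) -> rsymbol (of_rsymbol S) = S.
Proof. by move=> /rsymbol_surj hS; exact: xgetPex hS. Qed.

Lemma tau_lowP (e : nat) (m : int) (la : partition) :
  rsymbol (tau_low e m la) =
  (fun j : 'I_e => [set k : int | symbol m la ((j : nat)%:Z + k * e%:Z)]%classic).
Proof.
apply: of_rsymbolK => j; have je := ltn_ord j.
have [[N hN] [M hM]] := symbol_cofinal_below m la; split.
  exists (- `|N| - 1) => x xN; apply: hN; nia.
by exists (`|M| + 1) => x /hM; nia.
Qed.

Lemma tau_upP (e l : nat) (m : int) (la : partition) : (0 < e)%N ->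
  rsymbol (tau_up e l m la) =
  (fun i : 'I_l => tau_up_set e l m la (rev_ord i)).
Proof.
move=> e0; apply: of_rsymbolK => i; have il := ltn_ord (rev_ord i).
move: il; set d := nat_of_ord _; move=> il.
have [[N hN] [M hM]] := symbol_cofinal_below m la; split.
  exists (- (`|N| + e%:Z * l%:Z + e%:Z) * e%:Z) => x xN.
  have xE := divz_eq x e%:Z; have c0 : 0 <= (x %% e%:Z)%Z by apply: modz_ge0; lia.
  have ce : (x %% e%:Z)%Z < e%:Z by apply: ltz_pmod; lia.
  exists (x %% e%:Z)%Z, (x %/ e%:Z)%Z; split; [lia| |lia].
  move: (x %% e%:Z)%Z (x %/ e%:Z)%Z xE c0 ce => c q xE c0 ce; apply: hN.
  have qN : q < - (`|N| + e%:Z * l%:Z + e%:Z) by nia.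
  have ed : e%:Z * d%:Z + e%:Z <= e%:Z * l%:Z by nia.
  have el : 1 <= e%:Z * l%:Z by nia.
  have elq : e%:Z * l%:Z * q <= q by nia.
  lia.
exists ((`|M| + 1) * e%:Z) => x [c [q [/andP[c0 ce] /hM h ->]]].
have ed : 0 <= e%:Z * d%:Z by nia.
have el : 1 <= e%:Z * l%:Z by nia.
have qM : q <= `|M|.
  rewrite leNgt; apply/negP => Mq.
  have : q <= e%:Z * l%:Z * q by nia.
  lia.
by nia.
Qed.

(* The inverse of [tau_low]: see [tau_low_inj] and [tau_low_invK]. *)
Definition tau_low_inv (e : nat) (m : int) (p : rpartition e * multicharge e) :
  partition :=
  xget empty_part [set la | tau_low e m la = p]%classic.

Lemma symbol_remove (s t x : int) (la mu : partition) :
  symbol s la x -> (forall y, symbol s la y -> y <= x) ->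
  symbol t mu = [set y | symbol s la y /\ y <> x]%classic -> t + 1 = s.
Proof.
move=> lax xmax E.
have [|nu Enu] := @symbol_add t x mu.
  by move=> y; rewrite E => -[/xmax]; lia.
apply: (proj1 (@symbol_inj _ _ nu la _)).
rewrite Enu E; apply/seteqP; split=> y /=; first by move=> [->|[]].
by move=> lay; have [->|] := pselect (y = x); [left | right].
Qed.

Lemma modular_split (e : nat) (x : int) : (0 < e)%N ->
  exists (j : 'I_e) (k : int), x = (j : nat)%:Z + k * e%:Z.
Proof.
move=> e0; have c0 : 0 <= (x %% e%:Z)%Z by apply: modz_ge0; lia.
have ce : (x %% e%:Z)%Z < e%:Z by apply: ltz_pmod; lia.
have je : (`|(x %% e%:Z)%Z|%N < e)%N by lia.
exists (Ordinal je), (x %/ e%:Z)%Z; rewrite {1}(divz_eq x e%:Z) /=; lia.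
Qed.

Lemma modular_inj (e : nat) (i j : 'I_e) (h k : int) :
  (i : nat)%:Z + h * e%:Z = (j : nat)%:Z + k * e%:Z -> i = j /\ h = k.
Proof.
move=> E; have ie := ltn_ord i; have je := ltn_ord j.
have hk : h = k by nia.
by split=> //; apply: val_inj => /=; move: E; rewrite hk; lia.
Qed.

Lemma tau_low_sum (e : nat) (m : int) (la : partition) : (0 < e)%N ->
  \sum_i (tau_low e m la).2 i = m.
Proof.
move=> e0; have := tau_lowP e m la; case: (tau_low e m la) => mu s.
move=> /(congr1 (fun S i => S i)) E.
have {}E i : symbol (s i) (mu i) =
  [set k : int | symbol m la ((i : nat)%:Z + k * e%:Z)]%classic.
  exact: (congr1 (fun S => S i) E).
have [[N0 hN0] [M hM]] := symbol_cofinal_below m la.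
have [N hN] : exists N, forall x, x < N * e%:Z -> symbol m la x.
  by exists (- `|N0|) => x xN; apply: hN0; nia.
have [n hn] : exists n : nat, M <= N * e%:Z + n%:Z.
  by exists `|(M - N * e%:Z)%R|%N; lia.
have {hM hn} : forall x, symbol m la x -> x < N * e%:Z + n%:Z.
  by move=> x /hM; lia.
move=> hM {N0 hN0 M} /=.
elim: n m la mu s E hN hM => [|n IH] m la mu s E hN hM.
  have sE i : s i = N.
    apply: (proj1 (@symbol_inj _ _ (mu i) empty_part _)).
    have ie := ltn_ord i; rewrite E; apply/seteqP; split=> k /=.
      by move=> /hM h; apply/symbol_empty; nia.
    by move=> /symbol_empty kN; apply: hN; nia.
  have mE : m = N * e%:Z.
    apply: (proj1 (@symbol_inj _ _ la empty_part _)).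
    apply/seteqP; split=> x; first by move=> /hM h; apply/symbol_empty; lia.
    by move=> /symbol_empty; exact: hN.
  rewrite (eq_bigr (fun=> N)) // sumr_const card_ord mE.
  by rewrite -mulr_natr natz.
set x := N * e%:Z + n%:Z.
have [lax|lax] := pselect (symbol m la x); last first.
  apply: IH E hN _ => y lay; have := hM y lay.
  by case: (y =P x) lay => [-> //|]; rewrite /x; lia.
have xmax y : symbol m la y -> y <= x by move=> /hM; rewrite /x; lia.
have [|y [lay yx]|m' [la' E']] :=
  @symbol_surj [set y | symbol m la y /\ y <> x]%classic (N * e%:Z) x.
- by move=> y yN; split; [exact: hN | rewrite /x; lia].
- by have := xmax y lay; lia.
have mm : m' + 1 = m by exact: symbol_remove lax xmax E'.
have [j [k xjk]] := modular_split x e0.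
have := tau_lowP e m' la'; case: (tau_low e m' la') => mu' s' /= F.
have {}F i : symbol (s' i) (mu' i) =
  [set k : int | symbol m' la' ((i : nat)%:Z + k * e%:Z)]%classic.
  exact: (congr1 (fun S => S i) F).
have sums' : \sum_i s' i = m'.
  apply: IH F _ _ => y.
    by move=> yN; rewrite E'; split; [exact: hN | rewrite /x; lia].
  by rewrite E' => -[/xmax]; rewrite /x; lia.
have sj : s' j + 1 = s j.
  apply: (@symbol_remove _ _ k (mu j) (mu' j)).
  - by rewrite E /= -xjk.
  - by move=> h; rewrite E /= => /xmax; rewrite xjk; nia.
  rewrite F E' E; apply/seteqP; split=> h /= [h1 h2]; split=> //.
    by move=> hk; apply: h2; rewrite hk xjk.
  by rewrite xjk => /modular_inj[_ /h2].
have si i : i != j -> s' i = s i.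
  move=> ij; apply: (proj1 (@symbol_inj _ _ (mu' i) (mu i) _)).
  rewrite F E' E; apply/seteqP; split=> h /=; first by case.
  move=> h1; split=> //; rewrite xjk => /modular_inj[/eqP].
  by rewrite (negbTE ij).
rewrite -mm -sums' (bigD1 j) //= [in RHS](bigD1 j) //= -sj.
rewrite (eq_bigr s') => [|i ij]; last by rewrite si.
ring.
Qed.

Lemma tau_low_inj (e : nat) (m : int) : (0 < e)%N -> injective (tau_low e m).
Proof.
move=> e0 la mu E; apply: (proj2 (@symbol_inj m m _ _ _)).
have H x : symbol m la x = symbol m mu x.
  have [j [k ->]] := modular_split x e0.
  have := tau_lowP e m la; rewrite E tau_lowP => /(congr1 (fun S => S j k)).
  by move=> /= ->.
exact/funext.
Qed.

Lemma tau_low_invK (e : nat) (m : int) (p : rpartition e * multicharge e) :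
  (0 < e)%N -> \sum_i p.2 i = m -> tau_low e m (tau_low_inv m p) = p.
Proof.
move=> e0 pm; apply: (@xgetPex _ empty_part [set la | tau_low e m la = p]%classic).
pose X := [set x | exists (j : 'I_e) (k : int),
  x = (j : nat)%:Z + k * e%:Z /\ rsymbol p j k]%classic.
have [NN hNN] := choice (fun j : 'I_e =>
  proj1 (symbol_cofinal_below (p.2 j) (p.1 j))).
have [MM hMM] := choice (fun j : 'I_e =>
  proj2 (symbol_cofinal_below (p.2 j) (p.1 j))).
have NB j : - (\sum_i `|NN i|) <= NN j.
  have : `|NN j| <= \sum_i `|NN i|.
    by rewrite (bigD1 j) //= lerDl sumr_ge0.
  lia.
have MB j : MM j <= \sum_i `|MM i|.
  have : `|MM j| <= \sum_i `|MM i|.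
    by rewrite (bigD1 j) //= lerDl sumr_ge0.
  lia.
have [||t [la E]] := @symbol_surj X (- (\sum_i `|NN i|) * e%:Z)
    ((\sum_i `|MM i|) * e%:Z).
- move=> x; have [j [k ->]] := modular_split x e0 => h.
  by exists j, k; split=> //; apply: hNN; have := NB j; nia.
- move=> x [j [k [-> /hMM h]]]; have := MB j; have := ltn_ord j; nia.
have tp : tau_low e t la = p.
  apply: rsymbol_inj; rewrite tau_lowP; apply/funext => j.
  apply/seteqP; split=> k /=; rewrite E.
    by move=> [i [h [/modular_inj[-> ->]]]].
  by move=> pk; exists j, k.
by exists la; rewrite /= -pm -tp tau_low_sum.
Qed.

Definition assoc_core (e l : nat) (m : int) (s : multicharge e) :
  rpartition l * multicharge l :=
  tau_up e l m (tau_low_inv m (empty_rpart e, s)).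

Definition assoc_multicharge (e l : nat) (m : int) (s : multicharge e) :
  multicharge l := (assoc_core l m s).2.

(* Indices of the generators are taken modulo e: [ordS c] is c + 1 and
   [ord_pred c] is c - 1. There is no braid relation when e = 2. *)
Section AffineSymmetricGroup.
Variable e : nat.
Implicit Types u v w : seq 'I_e.

Definition adjacent (i j : 'I_e) := (j == ordS i) || (i == ordS j).

Variant coxeter_relation : seq 'I_e -> seq 'I_e -> Prop :=
| CoxSquare i : coxeter_relation [:: i; i] [::]
| CoxBraid i j : (3 <= e)%N -> adjacent i j ->
    coxeter_relation [:: i; j; i] [:: j; i; j]
| CoxCommute i j : i != j -> ~~ adjacent i j ->
    coxeter_relation [:: i; j] [:: j; i].

Inductive coxeter_equiv : seq 'I_e -> seq 'I_e -> Prop :=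
| cox_rel a u v b : coxeter_relation u v ->
    coxeter_equiv (a ++ u ++ b) (a ++ v ++ b)
| cox_refl u : coxeter_equiv u u
| cox_sym u v : coxeter_equiv u v -> coxeter_equiv v u
| cox_trans u v w :
    coxeter_equiv u v -> coxeter_equiv v w -> coxeter_equiv u w.

Definition coxeter_eqb : rel (seq 'I_e) := fun u v => `[< coxeter_equiv u v >].

Lemma coxeter_eqb_refl : reflexive coxeter_eqb.
Proof. by move=> u; apply/asboolP; exact: cox_refl. Qed.
Lemma coxeter_eqb_sym : symmetric coxeter_eqb.
Proof. by move=> u v; apply/asboolP/asboolP; exact: cox_sym. Qed.
Lemma coxeter_eqb_trans : transitive coxeter_eqb.
Proof.
by move=> v u w /asboolP uv /asboolP vw; apply/asboolP; exact: cox_trans uv vw.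
Qed.

Canonical coxeter_equiv_rel :=
  EquivRel coxeter_eqb coxeter_eqb_refl coxeter_eqb_sym coxeter_eqb_trans.

Definition affine_sym := {eq_quot coxeter_equiv_rel}.
HB.instance Definition _ := Choice.on affine_sym.
HB.instance Definition _ := EqQuotient.on affine_sym.

Lemma affine_symP u v : \pi_affine_sym u = \pi_affine_sym v <-> coxeter_equiv u v.
Proof.
split=> [/eqP|uv].
  by rewrite eqmodE => /asboolP.
by apply/eqP; rewrite eqmodE; apply/asboolP.
Qed.

Lemma cox_cat u u' v v' : coxeter_equiv u u' -> coxeter_equiv v v' ->
  coxeter_equiv (u ++ v) (u' ++ v').
Proof.
move=> uu' vv'; apply: (@cox_trans _ (u' ++ v)).
  elim: uu' => {u u'} [a x y b xy|x|x y _|x y z _ xy _].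
  - by rewrite -!catA; exact: cox_rel.
  - exact: cox_refl.
  - exact: cox_sym.
  - exact: cox_trans.
elim: vv' => {v v'} [a x y b xy|x|x y _|x y z _ xy _].
- by rewrite !(catA u'); exact: cox_rel.
- exact: cox_refl.
- exact: cox_sym.
- exact: cox_trans.
Qed.

Lemma cox_rev u v : coxeter_equiv u v -> coxeter_equiv (rev u) (rev v).
Proof.
elim=> {u v} [a x y b xy|x|x y _|x y z _ xy _].
- rewrite !rev_cat -!catA; apply: cox_rel; case: xy => [i|i j e3 ij|i j ij nij].
  + exact: CoxSquare.
  + exact: CoxBraid.
  + by apply: CoxCommute; [rewrite eq_sym | rewrite /adjacent orbC].
- exact: cox_refl.
- exact: cox_sym.
- exact: cox_trans.
Qed.

Lemma cox_revV u : coxeter_equiv (rev u ++ u) [::].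
Proof.
elim: u => [|i u IH]; first exact: cox_refl.
apply: cox_trans IH; rewrite rev_cons -cats1 -catA /=.
exact: (cox_rel (rev u) u (CoxSquare i)).
Qed.

Definition affine_one : affine_sym := \pi_affine_sym [::].
Definition affine_mul (g h : affine_sym) : affine_sym :=
  \pi_affine_sym (repr g ++ repr h).
Definition affine_inv (g : affine_sym) : affine_sym :=
  \pi_affine_sym (rev (repr g)).

Lemma repr_pi u : coxeter_equiv (repr (\pi_affine_sym u)) u.
Proof. by apply/affine_symP; rewrite reprK. Qed.

Lemma affine_mul_pi u v :
  affine_mul (\pi u) (\pi v) = \pi_affine_sym (u ++ v).
Proof. by apply/affine_symP; apply: cox_cat; exact: repr_pi. Qed.

Lemma affine_inv_pi u : affine_inv (\pi u) = \pi_affine_sym (rev u).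
Proof. by apply/affine_symP; apply: cox_rev; exact: repr_pi. Qed.

Lemma affine_mulA : associative affine_mul.
Proof.
move=> f g h; rewrite -[f]reprK -[g]reprK -[h]reprK.
by rewrite !affine_mul_pi catA.
Qed.
Lemma affine_mul1 : left_id affine_one affine_mul.
Proof. by move=> g; rewrite -[g]reprK affine_mul_pi. Qed.
Lemma affine_mulr1 : right_id affine_one affine_mul.
Proof. by move=> g; rewrite -[g]reprK affine_mul_pi cats0. Qed.
Lemma affine_mulV : left_inverse affine_one affine_inv affine_mul.
Proof.
move=> g; rewrite -[g]reprK affine_inv_pi affine_mul_pi.
by apply/affine_symP; exact: cox_revV.
Qed.
Lemma affine_mulrV : right_inverse affine_one affine_inv affine_mul.
Proof.
move=> g; rewrite -[g]reprK affine_inv_pi affine_mul_pi.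
by apply/affine_symP; have := cox_revV (rev (repr g)); rewrite revK.
Qed.

HB.instance Definition _ := isGroup.Build affine_sym
  affine_mulA affine_mul1 affine_mulr1 affine_mulV affine_mulrV.

Definition affine_gen (i : 'I_e) : affine_sym := \pi_affine_sym [:: i].

End AffineSymmetricGroup.

Section Action.
Variables e l : nat.

Definition sigma (c : 'I_e) (s : multicharge e) : multicharge e :=
  let b := ord_pred c in (* c - 1, or e - 1 if c = 0 *)
  if c == 0%N :> nat then
    [ffun j => if j == c then s b + l%:Z else if j == b then s c - l%:Z else s j]
  else [ffun j => s (tperm b c j)].

(* For 2 <= e this does not depend on the chosen word: see [act_pi]. *)
Definition act (g : affine_sym e) (s : multicharge e) : multicharge e :=
  foldr sigma s (repr g).

Lemma ord_predE (c : 'I_e) :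
  (ord_pred c : nat) = if c == 0%N :> nat then e.-1 else c.-1.
Proof.
rewrite /=; have ce := ltn_ord c; case: eqP => [->|/eqP c0].
  by rewrite add0n modn_small // prednK //; lia.
have -> : (c + e).-1 = (e + c.-1)%N by lia.
by rewrite modnDl modn_small //; lia.
Qed.

Lemma ordSE (c : 'I_e) : (ordS c : nat) = if c == e.-1 :> nat then 0%N else c.+1.
Proof.
rewrite /=; have ce := ltn_ord c; case: eqP => [->|/eqP c0].
  by rewrite prednK ?modnn //; lia.
by rewrite modn_small //; lia.
Qed.

Lemma sigmaE (c : 'I_e) s j : (1 < e)%N ->
  sigma c s j = if j == c then s (ord_pred c) + (if c == 0%N :> nat then l%:Z else 0)
    else if j == ord_pred c then s c - (if c == 0%N :> nat then l%:Z else 0)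
    else s j.
Proof.
move=> e2; rewrite /sigma; case: ifP => c0; rewrite ffunE //.
rewrite addr0 subr0; case: tpermP => [->|->|/eqP/negbTE-> /eqP/negbTE->] //.
  by rewrite eqxx; case: eqVneq => // ->.
by rewrite eqxx.
Qed.


Lemma sigma_sum (c : 'I_e) s : (1 < e)%N ->
  \sum_i sigma c s i = \sum_i s i.
Proof.
move=> e2; have bc : ord_pred c != c.
  apply/eqP => bc; have := ord_predE c; rewrite bc; case: ifP; lia.
rewrite (bigD1 c) // (bigD1 (ord_pred c)) //= [RHS](bigD1 c) //.
rewrite [in RHS](bigD1 (ord_pred c)) //= !addrA; congr (_ + _).
  by rewrite !sigmaE // !eqxx (negbTE bc); case: ifP => _; ring.
by apply: eq_bigr => i /andP[/negbTE ic /negbTE ib]; rewrite sigmaE // ic ib.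
Qed.

Lemma ord_pred_neq (c : 'I_e) : (1 < e)%N -> (ord_pred c == c) = false.
Proof.
move=> e2; apply/eqP => bc; have := ord_predE c; rewrite bc; case: ifP; lia.
Qed.

Lemma sigma_square (c : 'I_e) s : (1 < e)%N -> sigma c (sigma c s) = s.
Proof.
move=> e2; apply/ffunP => j; rewrite !sigmaE // !eqxx ord_pred_neq //.
have [->|jc] := eqVneq j c; first by rewrite subrK.
by have [->|//] := eqVneq j (ord_pred c); rewrite addrK.
Qed.

Lemma sigma_braid (i : 'I_e) s : (2 < e)%N ->
  sigma i (sigma (ordS i) (sigma i s)) =
  sigma (ordS i) (sigma i (sigma (ordS i) s)).
Proof.
move=> e3; have e2 : (1 < e)%N by exact: ltnW.
have := ord_predE i; have := ordSE i; have := ltn_ord i.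
have pb := ordSK i; move: pb.
set a := ord_pred i; set b := ordS i => pb ie bE aE.
have ba : (b == a) = false.
  by apply/eqP => h; move: aE bE; rewrite h; do 2 case: ifP; lia.
have ab : (a == b) = false by rewrite eq_sym.
have bi : (b == i) = false.
  by apply/eqP => h; move: bE; rewrite h; case: ifP; lia.
have ib : (i == b) = false by rewrite eq_sym.
have ai : (a == i) = false by exact: ord_pred_neq.
have ia : (i == a) = false by rewrite eq_sym.
apply/ffunP => j; rewrite !(sigmaE, pb, eqxx) // -/a.
rewrite !(ab, ba, ib, bi, ai, ia, eqxx).
have [->|ji] := eqVneq j i.
  by rewrite ?(ab, ba, ib, bi, ai, ia, eqxx); ring.
have [->|jb] := eqVneq j b.
  by rewrite ?(ab, ba, ib, bi, ai, ia, eqxx); ring.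
by case: (j == a).
Qed.

Lemma sigma_commute (i j : 'I_e) s : (1 < e)%N ->
  i != j -> ~~ adjacent i j -> sigma i (sigma j s) = sigma j (sigma i s).
Proof.
move=> e2 /negbTE ij; rewrite negb_or => /andP[nji nij].
have pi := ord_pred_neq i e2; have pj := ord_pred_neq j e2.
have ji : (j == i) = false by rewrite eq_sym.
have ai : (ord_pred i == j) = false.
  by apply/eqP => h; move: nij; rewrite -h ord_predK eqxx.
have aj : (ord_pred j == i) = false.
  by apply/eqP => h; move: nji; rewrite -h ord_predK eqxx.
have aij : (ord_pred i == ord_pred j) = false.
  by apply/eqP => /(can_inj (@ord_predK e)) /eqP; rewrite ij.
have aji : (ord_pred j == ord_pred i) = false by rewrite eq_sym.
have ai' : (j == ord_pred i) = false by rewrite eq_sym.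
have aj' : (i == ord_pred j) = false by rewrite eq_sym.
apply/ffunP => k; rewrite !sigmaE //.
rewrite !(ij, ji, ai, aj, aij, aji, ai', aj').
have [->|ki] := eqVneq k i; first by rewrite ?(ij, ji, aj').
by have [->|kb] := eqVneq k (ord_pred i); rewrite ?(ai, aij).
Qed.

Lemma sigma_coxeter (u v : seq 'I_e) s : (1 < e)%N ->
  coxeter_relation u v -> foldr sigma s u = foldr sigma s v.
Proof.
move=> e2 [i|i j e3 /orP[] /eqP->|i j ij nij] /=.
- exact: sigma_square.
- exact: sigma_braid.
- by rewrite sigma_braid.
- exact: sigma_commute.
Qed.

Lemma sigma_coxeter_equiv (u v : seq 'I_e) s : (1 < e)%N ->
  coxeter_equiv u v -> foldr sigma s u = foldr sigma s v.
Proof.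
move=> e2 uv; elim: uv s => {u v} [a u v b uv|u|u v _ IH|u v w _ IH1 _ IH2] s //.
- by rewrite !foldr_cat; congr foldr; exact: sigma_coxeter.
- by rewrite IH1.
Qed.

Lemma act_pi (u : seq 'I_e) s : (1 < e)%N ->
  act (\pi u) s = foldr sigma s u.
Proof. by move=> e2; apply: sigma_coxeter_equiv => //; exact: repr_pi. Qed.

Lemma act_gen (c : 'I_e) s : (1 < e)%N -> act (affine_gen c) s = sigma c s.
Proof. exact: act_pi. Qed.

Lemma act_one s : (1 < e)%N -> act 1%g s = s.
Proof. exact: act_pi. Qed.

Lemma act_mul (g h : affine_sym e) s : (1 < e)%N ->
  act (g * h)%g s = act g (act h s).
Proof.
move=> e2; rewrite -[g]reprK -[h]reprK [(_ * _)%g]affine_mul_pi !act_pi //.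
exact: foldr_cat.
Qed.

Lemma act_sum (g : affine_sym e) s : (1 < e)%N ->
  \sum_i act g s i = \sum_i s i.
Proof.
by move=> e2; rewrite /act; elim: (repr g) => //= c u IH; rewrite sigma_sum.
Qed.

(* The label B(s, w); for fixed m, the multicharges s with entries summing to m
   are stable under the action by [act_sum]. *)
Record block_label := B { label_core : multicharge e; label_weight : nat }.

Definition act_label (g : affine_sym e) (b : block_label) : block_label :=
  B (act g (label_core b)) (label_weight b).

Definition same_orbit (b b' : block_label) : Prop :=
  exists g : affine_sym e, act_label g b = b'.

End Action.

(* Main.v *)
Require Import Defs.
From mathcomp Require Import all_boot all_order all_algebra.
From mathcomp Require Import perm zify ring classical_sets.

Set Implicit Arguments.
Unset Strict Implicit.
Unset Printing Implicit Defensive.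

Import Order.TTheory GRing.Theory Num.Theory.
Local Open Scope ring_scope.

(** The partition with empty [e]-quotient and charges [s] has as symbol the set
    of the c + k e with 0 <= c < e and k < s c. Splitting it by tau^l, the set
    X_d consists of the c + k e with d + l k < s c. It is again the symbol of
    an [e]-core, whose c-th runner has charge ceil ((s c - d) / l), so the entry
    of the [l]-multicharge that comes from X_d is
    V(d) = sum_c ceil ((s c - d) / l) ([assoc_multichargeE]).

    The generators of the affine symmetric group exchange two entries of [s],
    possibly adding l to one of them and removing it from the other. Since
    ceil ((x + l - d) / l) = ceil ((x - d) / l) + 1, this leaves every V(d)
    unchanged, so the [l]-multicharge is constant on orbits.

    Conversely, V(d - 1) - V(d) is the number of entries of [s] congruent to d
    modulo l, and V(-1) = V(l - 1) + e. So the [l]-multicharge determines the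
    multiset of residues modulo l of the entries of [s]
    ([perm_eq_residues]). Two multicharges with the same multiset of residues
    become congruent modulo l entry by entry after a permutation, and having
    the same sum they then differ by an element of l times the root lattice of
    type A. Permutations ([linked_permute]) and translations by l times a root
    ([linked_translate]) all come from the affine symmetric group. *)

(** * The multicharge of the core *)

(** This is ceil ((x - d) / l). *)
Definition runner_charge (l : nat) (d x : int) : int :=
  ((x - d - 1) %/ l%:Z)%Z + 1.

Lemma lt_runner_charge (l : nat) (d x k : int) : (0 < l)%N ->
  (k < runner_charge l d x) = (d + l%:Z * k < x).
Proof. by move=> l0; rewrite ltzD1 lez_divRL; [apply/idP/idP; lia | lia]. Qed.

Lemma runner_charge_eq (l : nat) (d x k : int) : (0 < l)%N ->
  d + l%:Z * (k - 1) < x <= d + l%:Z * k -> runner_charge l d x = k.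
Proof.
move=> l0 /andP[]; rewrite -lt_runner_charge // leNgt -lt_runner_charge //; lia.
Qed.

Lemma runner_chargeDr (l : nat) (d x : int) : (0 < l)%N ->
  runner_charge l d (x + l%:Z) = runner_charge l d x + 1.
Proof.
move=> l0; rewrite /runner_charge.
have -> : x + l%:Z - d - 1 = 1 * l%:Z + (x - d - 1) by ring.
by rewrite divzMDl; [ring | lia].
Qed.

Lemma runner_chargeBl (l : nat) (d x : int) :
  runner_charge l (d - l%:Z) x = runner_charge l d (x + l%:Z).
Proof. by rewrite /runner_charge; congr (divz _ _ + _); ring. Qed.

(** The ceiling of (x - d) / l drops as d - 1 increases to d exactly when l
    divides x - d. *)
Lemma runner_charge_step (l : nat) (d x : int) : (0 < l)%N -> 0 <= d < l%:Z ->
  runner_charge l (d - 1) x = runner_charge l d x + ((x %% l%:Z)%Z == d)%:R.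
Proof.
move=> l0 dl; have xE := divz_eq x l%:Z.
have r0 : 0 <= (x %% l%:Z)%Z by apply: modz_ge0; lia.
have rl : (x %% l%:Z)%Z < l%:Z by apply: ltz_pmod; lia.
move: (x %/ l%:Z)%Z (x %% l%:Z)%Z xE r0 rl => q r -> r0 rl.
case: (ltgtP r d) => rd.
- by rewrite !(@runner_charge_eq l _ _ q) //=; lia.
- by rewrite !(@runner_charge_eq l _ _ (q + 1)) //=; lia.
- by rewrite (@runner_charge_eq l (d - 1) _ (q + 1))
             ?(@runner_charge_eq l d _ q) //=; lia.
Qed.

Lemma symbol_core (e : nat) (m : int) (s : multicharge e) (c : 'I_e) (k : int) :
  (0 < e)%N -> \sum_i s i = m ->
  symbol m (tau_low_inv m (empty_rpart e, s)) ((c : nat)%:Z + k * e%:Z) <->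
  k < s c.
Proof.
move=> e0 sm.
have /(congr1 (fun S => S c k)) := tau_lowP e m (tau_low_inv m (empty_rpart e, s)).
by rewrite tau_low_invK //= => <-; rewrite /rsymbol /= ffunE; exact: symbol_empty.
Qed.

(** The set X_d meets the runner c in the k with c + (d + l k) e in the symbol
    of the core, that is, with d + l k < s c. These k form the symbol of the
    empty partition with charge ceil ((s c - d) / l). *)
Lemma assoc_multichargeE (e l : nat) (m : int) (s : multicharge e) (i : 'I_l) :
  (0 < e)%N -> (0 < l)%N -> \sum_c s c = m ->
  assoc_multicharge l m s i =
  \sum_c runner_charge l (rev_ord i : nat)%:Z (s c).
Proof.
move=> e0 l0 sm; rewrite /assoc_multicharge.
set p := assoc_core l m s.
have Xi x : symbol (p.2 i) (p.1 i) x <->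
    tau_up_set e l m (tau_low_inv m (empty_rpart e, s)) (rev_ord i) x.
  by have /(congr1 (fun S => S i x)) := tau_upP l m
       (tau_low_inv m (empty_rpart e, s)) e0; rewrite /rsymbol -/p => ->.
(* The charge of a symbol is the sum of the charges of its e runners. *)
rewrite -[LHS](@tau_low_sum e _ (p.1 i) e0); apply: eq_bigr => c _.
have /(congr1 (fun S => S c)) := tau_lowP e (p.2 i) (p.1 i).
rewrite /rsymbol => E.
apply: (proj1 (@symbol_inj _ _ ((tau_low e (p.2 i) (p.1 i)).1 c) empty_part _)).
rewrite E; apply/seteqP.
have ce := ltn_ord c.
suff H k : symbol (p.2 i) (p.1 i) ((c : nat)%:Z + k * e%:Z) <->
    k < runner_charge l (rev_ord i : nat)%:Z (s c).
  by split=> k /=; rewrite H => /symbol_empty.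
rewrite Xi lt_runner_charge // -(symbol_core c _ e0 sm).
set d := (rev_ord i : nat)%:Z; rewrite /tau_up_set.
have dE q : (c : nat)%:Z + e%:Z * d + e%:Z * l%:Z * q =
    (c : nat)%:Z + (d + l%:Z * q) * e%:Z by ring.
split=> [[c' [q [c'e h E']]]|h].
  have [c'c qk] : c' = (c : nat)%:Z /\ q = k.
    have qk : q = k by nia.
    by split=> //; move: E'; rewrite qk; lia.
  by rewrite -dE -c'c -qk.
by exists (c : nat)%:Z, k; split; [lia | rewrite dE | ring].
Qed.

(** * Invariance along orbits *)

(** Only the shift by l in the generator of index 0 could change the sum: one
    entry gains l and another loses l, so the two changes of [f] cancel. *)
Lemma sum_sigma (e l : nat) (a : int) (f : int -> int) (c : 'I_e)
    (s : multicharge e) : (1 < e)%N -> (forall x, f (x + l%:Z) = f x + a) ->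
  \sum_i f (sigma l c s i) = \sum_i f (s i).
Proof.
move=> e2 fl; have bc := ord_pred_neq c e2.
have fl' x : f (x - l%:Z) = f x - a by rewrite -[in RHS](subrK l%:Z x) fl addrK.
rewrite (bigD1 c) // (bigD1 (ord_pred c)) ?bc //= [RHS](bigD1 c) //.
rewrite [in RHS](bigD1 (ord_pred c)) ?bc //= !addrA; congr (_ + _).
  rewrite !sigmaE // !eqxx bc.
  by case: ifP => _; rewrite ?fl ?fl' ?addr0 ?subr0; ring.
by apply: eq_bigr => i /andP[/negbTE ic /negbTE ib]; rewrite sigmaE // ic ib.
Qed.

Lemma sum_act (e l : nat) (a : int) (f : int -> int) (g : affine_sym e)
    (s : multicharge e) : (1 < e)%N -> (forall x, f (x + l%:Z) = f x + a) ->
  \sum_i f (act l g s i) = \sum_i f (s i).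
Proof.
move=> e2 fl; rewrite /act; elim: (repr g) => //= c u IH.
by rewrite (sum_sigma _ _ e2 fl).
Qed.

(** * Residues modulo l *)

Definition residues (e l : nat) (s : multicharge e) : e.-tuple int :=
  [tuple (s c %% l%:Z)%Z | c < e].

Lemma count_residues (e l : nat) (s : multicharge e) (r : int) :
  (0 < l)%N -> 0 <= r < l%:Z ->
  (count_mem r (residues l s))%:Z =
  \sum_c runner_charge l (r - 1) (s c) - \sum_c runner_charge l r (s c).
Proof.
move=> l0 rl; rewrite -sum1_count /= big_map big_enum_cond /=.
rewrite -sumrB -natz natr_sum big_mkcond /=; apply: eq_bigr => c _.
by rewrite runner_charge_step // addrC addKr; case: ifP.
Qed.

(** The number of entries with residue d is V(d - 1) - V(d). *)
Lemma perm_eq_residues (e l : nat) (s s' : multicharge e) : (0 < l)%N ->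
  (forall d, 0 <= d < l%:Z ->
    \sum_c runner_charge l d (s c) = \sum_c runner_charge l d (s' c)) ->
  perm_eq (residues l s') (residues l s).
Proof.
move=> l0 V; apply/allP => r rin; apply/eqP/eqP; rewrite -eqz_nat; apply/eqP.
have rl : 0 <= r < l%:Z.
  move: rin; rewrite mem_cat => /orP[] /mapP[c _ ->];
  by apply/andP; split; [apply: modz_ge0 | apply: ltz_pmod]; lia.
rewrite !count_residues // (V r) //; congr (_ - _).
have [r0|r0] := eqVneq r 0; last by rewrite V //; lia.
(* V(-1) is not given by the hypothesis, but V(-1) = V(l - 1) + e. *)
have wrap (t : multicharge e) : \sum_c runner_charge l (r - 1) (t c) =
    \sum_c runner_charge l (l%:Z - 1) (t c) + \sum_(c < e) 1.
  rewrite -big_split; apply: eq_bigr => c _ /=.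
  by rewrite -runner_chargeDr // -runner_chargeBl; congr runner_charge; lia.
by rewrite !wrap V //; lia.
Qed.

(** * Permutations and translations in the affine symmetric group *)

Definition linked (e l : nat) (s s' : multicharge e) : Prop :=
  exists g : affine_sym e, act l g s = s'.

Definition permute (e : nat) (p : {perm 'I_e}) (s : multicharge e) :
  multicharge e := [ffun x => s (p x)].

(** Adds l times the multiple [k] of the root eps_i - eps_j. *)
Definition translate (e l : nat) (i j : 'I_e) (k : int) (s : multicharge e) :
  multicharge e :=
  [ffun x => s x + k * l%:Z * ((x == i)%:R - (x == j)%:R)].

Section Linked.
Variables e l : nat.
Hypothesis e2 : (1 < e)%N.
Implicit Types (s : multicharge e) (p q : {perm 'I_e}).

Lemma linked_refl s : linked l s s.
Proof. by exists 1%g; exact: act_one. Qed.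

Lemma linked_trans s1 s2 s3 : linked l s1 s2 -> linked l s2 s3 -> linked l s1 s3.
Proof. by move=> [g <-] [h <-]; exists (h * g)%g; exact: act_mul. Qed.

Lemma linked_sigma c s : linked l s (sigma l c s).
Proof. by exists (affine_gen c); exact: act_gen. Qed.

Lemma permute1 s : permute 1 s = s.
Proof. by apply/ffunP => x; rewrite ffunE perm1. Qed.

Lemma permuteM p q s : permute (p * q) s = permute p (permute q s).
Proof. by apply/ffunP => x; rewrite !ffunE permM. Qed.

Lemma linked_permuteM p q : (forall s, linked l s (permute p s)) ->
  (forall s, linked l s (permute q s)) -> forall s, linked l s (permute (p * q) s).
Proof. by move=> hp hq s; rewrite permuteM; apply: linked_trans (hq s) (hp _). Qed.

(** From the adjacent transpositions, the transposition of i and j + 1 is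
    obtained as the conjugate of that of i and j by that of j and j + 1. *)
Lemma linked_tperm_lt (i j : 'I_e) s :
  (i < j)%N -> linked l s (permute (tperm i j) s).
Proof.
case: j => j je /=; elim: j je s => // j IH je s ij.
have je' : (j < e)%N by exact: ltnW.
have adj t : linked l t (permute (tperm (Ordinal je') (Ordinal je)) t).
  have -> : Ordinal je' = ord_pred (Ordinal je).
    by apply: val_inj; rewrite [RHS]ord_predE.
  exact: linked_sigma (Ordinal je) t.
have [ij'|ij'] := eqVneq (i : nat) j.
  by have -> : i = Ordinal je' by exact: val_inj.
have ltij : (i < j)%N by lia.
have -> : tperm i (Ordinal je) =
    (tperm i (Ordinal je') ^ tperm (Ordinal je') (Ordinal je))%g.
  by rewrite tpermJ tpermL tpermD // -val_eqE /=; lia.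
rewrite /conjg tpermV.
by apply: linked_permuteM => // t; apply: linked_permuteM => // u; exact: IH.
Qed.

Lemma linked_permute p s : linked l s (permute p s).
Proof.
have [ts -> _] := prod_tpermP p.
elim: ts s => [|[i j] ts IH] s; first by rewrite big_nil permute1; exact: linked_refl.
rewrite big_cons; apply: linked_permuteM => // {}s /=.
case: (ltngtP i j) => [ij|ji|/val_inj ->]; first exact: linked_tperm_lt.
  by rewrite tpermC; exact: linked_tperm_lt.
by rewrite tperm1 permute1; exact: linked_refl.
Qed.

(** Exchanging the entries 0 and e - 1 after applying the generator of index 0
    moves l from the entry 0 to the entry e - 1. Conjugating by a permutation
    moves this pair to (j, i). *)
Lemma linked_translate1 (i j : 'I_e) s :
  i != j -> linked l s (translate l i j 1 s).
Proof.
move=> ij; pose z := Ordinal (ltnW e2); pose b := ord_pred z.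
have bz : (b == z) = false by exact: ord_pred_neq.
have zb : (z == b) = false by rewrite eq_sym.
have [p pb pz] : exists2 p : {perm 'I_e}, p b = i & p z = j.
  exists (tperm b i * tperm (tperm b i z) j)%g; rewrite permM ?tpermL //.
  rewrite (@tpermD _ (tperm b i z)) //; last by rewrite eq_sym.
  by rewrite -[X in _ != X](tpermL b i) (inj_eq perm_inj) zb.
have link0 t : linked l t (translate l b z 1 t).
  have -> : translate l b z 1 t = permute (tperm b z) (sigma l z t).
    apply/ffunP => x; rewrite [RHS]ffunE sigmaE // -/b [LHS]ffunE.
    case: tpermP => [->|->|/eqP/negbTE xb /eqP/negbTE xz].
    - by rewrite !eqxx bz /=; ring.
    - by rewrite !eqxx bz zb /=; ring.
    - by rewrite xb xz /=; ring.
  exact: linked_trans (linked_sigma z t) (linked_permute _ _).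
have -> : translate l i j 1 s = permute p^-1 (translate l b z 1 (permute p s)).
  apply/ffunP => x; rewrite !ffunE permKV -pb -pz.
  by rewrite !(canF_eq (permKV p)).
apply: linked_trans (linked_permute p s) _.
exact: linked_trans (link0 _) (linked_permute _ _).
Qed.

Lemma linked_translate (i j : 'I_e) (k : int) s :
  i != j -> linked l s (translate l i j k s).
Proof.
have nonneg (n : nat) (i' j' : 'I_e) :
    i' != j' -> linked l s (translate l i' j' n%:Z s).
  move=> ij; elim: n => [|n IH].
    have -> : translate l i' j' 0 s = s.
      by apply/ffunP => x; rewrite ffunE !mul0r addr0.
    exact: linked_refl.
  have -> : translate l i' j' n.+1%:Z s =
      translate l i' j' 1 (translate l i' j' n%:Z s).
    by apply/ffunP => x; rewrite !ffunE -addn1 PoszD; ring.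
  exact: linked_trans IH (linked_translate1 _ ij).
move=> ij; case: (leP 0 k) => k0.
  by have := nonneg `|k|%N i j ij; rewrite gez0_abs.
have -> : translate l i j k s = translate l j i `|k|%N%:Z s.
  by apply/ffunP => x; rewrite !ffunE ltz0_abs //; ring.
by apply: nonneg; rewrite eq_sym.
Qed.

(** The entries other than the entry z are corrected one after the other by
    translations along eps_i - eps_z; the entry z is then determined by the
    sum. *)
Lemma linked_residues s s' : \sum_c s c = \sum_c s' c ->
  (forall c, (s c %% l%:Z)%Z = (s' c %% l%:Z)%Z) -> linked l s s'.
Proof.
pose z := Ordinal (ltnW e2).
have [n] := ubnP #|[pred x | (x != z) && (s x != s' x)]|.
elim: n s => // n IH s /ltnSE-lesn sums res.
case: (pickP [pred x | (x != z) && (s x != s' x)]) => [i /andP[/= iz si]|all_eq].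
  have [k kE] : exists k, s' i - s i = k * l%:Z.
    exists ((s' i %/ l%:Z)%Z - (s i %/ l%:Z)%Z).
    by rewrite {1}(divz_eq (s' i) l%:Z) {1}(divz_eq (s i) l%:Z) res; ring.
  apply: linked_trans (linked_translate k s iz) _; apply: IH.
  - apply: leq_trans lesn; apply: proper_card; apply/properP; split.
      apply/fintype.subsetP => x; rewrite !inE ffunE => /andP[xz]; rewrite xz /=.
      have [->|_] := eqVneq x i; first by rewrite si.
      by rewrite (negbTE xz) subrr mulr0 addr0.
    exists i; rewrite !inE ?iz // ffunE eqxx (negbTE iz) /= subr0 mulr1 -kE.
    by rewrite addrC subrK eqxx.
  - rewrite -sums; under eq_bigr do rewrite ffunE.
    rewrite big_split /= -mulr_sumr sumrB.
    have delta (j : 'I_e) : \sum_x (x == j)%:R = 1 :> int.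
      by rewrite (bigD1 j) //= eqxx big1 ?addr0 // => x /negbTE ->.
    by rewrite !delta subrr mulr0 addr0.
  - by move=> c; rewrite ffunE -mulrA (mulrCA k) mulrC addrC modzMDl res.
have sE x : x != z -> s x = s' x.
  by move=> xz; have := all_eq x; rewrite /= xz => /negbFE/eqP.
have -> : s = s'; last exact: linked_refl.
apply/ffunP => x; have [->|/sE//] := eqVneq x z.
move: sums; rewrite (bigD1 z) //= [RHS](bigD1 z) //= (eq_bigr s') //.
exact: addIr.
Qed.

(** Equal multisets of residues are matched by a permutation, which reduces to
    entrywise congruence. *)
Lemma linked_perm_eq s s' : \sum_c s c = \sum_c s' c ->
  perm_eq (residues l s') (residues l s) -> linked l s s'.
Proof.
move=> sums /tuple_permP[p /val_inj pE].
apply: linked_trans (linked_permute p s) _; apply: linked_residues.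
  rewrite -sums [RHS](reindex_inj (@perm_inj _ p)).
  by apply: eq_bigr => c _; rewrite ffunE.
move=> c; have := congr1 (fun t => tnth t c) pE.
by rewrite !tnth_mktuple ffunE => ->.
Qed.

End Linked.

(** * Orbits and multicharges *)

Theorem proposition6p1 (e l : nat) (m : int) (he : (2 <= e)%N) (hl : (1 <= l)%N)
    (s s' : multicharge e) (hs : \sum_i s i = m) (hs' : \sum_i s' i = m)
    (w : nat) :
  same_orbit l (B s w) (B s' w) <->
  assoc_multicharge l m s = assoc_multicharge l m s'.
Proof.
have e0 : (0 < e)%N by exact: ltnW.
split=> [[g [<-]]|E].
  apply/ffunP => i; rewrite !assoc_multichargeE ?act_sum //; symmetry.
  by apply: (@sum_act e l 1) => // x; exact: runner_chargeDr.
suff lss' : perm_eq (residues l s') (residues l s).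
  have [||g gE] := @linked_perm_eq e l he s s' => //; first by rewrite hs.
  by exists g; rewrite /act_label /= gE.
apply: perm_eq_residues => // d dl.
have dl' : (`|d|%N < l)%N by lia.
have /(congr1 (fun v : multicharge l => v (rev_ord (Ordinal dl')))) := E.
by rewrite !assoc_multichargeE // rev_ordK /= gez0_abs //; lia.
Qed.
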